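(* Let $u$ be a real-valued $\mathcal{C}^2$ function defined over a domain $\Omega\subseteq\mathbb{R}^2$. Let $A=\{(x,y)\in\Omega: Du(x,y)=0\}$ be the set of critical points of $u$, and for $(x,y)\in\Omega\setminus A$ let $\tilde{k}(x,y)$ denote the curvature at $(x,y)$ of the level curve of $u$ through $(x,y)$. Let $A'$ be the set of accumulation points of $A$, and define $A^{2)}=(A')'$ and $A^{n)}=(A^{n-1)})'$ for $n>2$. If there exists $n$ such that $A^{n)}=\emptyset$, then $$\mathrm{inradius}(\Omega)\leq \frac{1}{\inf_{\Omega\setminus A}|\tilde{k}|}.$$
   Context: A domain is a nonempty connected open set. The inradius of a set in $\mathbb{R}^2$ is the supremum (possibly $+\infty$) of the radii of the closed discs contained in it. The right-hand side of the inequality is understood as $+\infty$ when $\inf|\tilde{k}|=0$. $Du$ denotes the Euclidean gradient of $u$. For a set $S\subseteq\Omega$, $S'$ denotes the set of accumulation points of $S$ in $\Omega$; $A^{1)}$ means $A'$. Near a point where $Du\neq0$ the level set of $u$ through that point is a regular $\mathcal{C}^2$ plane curve (the level curve), and $\tilde{k}$ is its curvature as a curve in the Euclidean plane; $\tilde k$ is signed with respect to a choice of unit normal (say the one pointing in the direction in which $u$ decreases), but only $|\tilde{k}|$ matters in the statement. *)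

(* Defs.v *)
(* The plane is [R * R] with [R : realType]. *)
From HB Require Import structures.
From mathcomp Require Import all_boot all_order all_algebra.
From mathcomp Require Import all_classical all_reals all_analysis.
Set Implicit Arguments.
Unset Strict Implicit.
Unset Printing Implicit Defensive.
Import Order.TTheory GRing.Theory Num.Theory.
Import numFieldNormedType.Exports.
Local Open Scope classical_set_scope.
Local Open Scope ring_scope.

Section plane.
Context {R : realType}.
Implicit Types (p q c v w : R * R) (D S U : set (R * R)) (u f : R * R -> R).

(* The library norm on [R * R] is the maximum norm (it induces the usual
   topology), so Euclidean lengths are spelled out. *)
Definition dot v w : R := v.1 * w.1 + v.2 * w.2.

Definition enorm v : R := Num.sqrt (dot v v).

Definition closed_disc c (r : R) : set (R * R) := [set p | enorm (p - c) <= r].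

Definition inradius D : \bar R :=
  ereal_sup [set r%:E | r in
    [set r : R | 0 < r /\ exists c, closed_disc c r `<=` D]].

Definition e1 : R * R := (1, 0).
Definition e2 : R * R := (0, 1).

(* Regularity is only required on [D]; a function defined on [D] is represented
   by any total extension of it. *)
Definition C1_on D f : Prop :=
  forall p v, D p -> v = e1 \/ v = e2 ->
    derivable f p v /\ {for p, continuous ('D_v f)}.

Definition C2_on D f : Prop :=
  [/\ C1_on D f, C1_on D ('D_e1 f) & C1_on D ('D_e2 f)].

Definition gradient u p : R * R := ('D_e1 u p, 'D_e2 u p).

Definition critical_set D u : set (R * R) := [set p | D p /\ gradient u p = 0].

(* Accumulation points lying in [D]. *)
Definition derived_set D S : set (R * R) := D `&` limit_point S.

Definition iterated_derived_set D S (n : nat) : set (R * R) :=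
  iter n (derived_set D) S.

Definition regular_C2_curve (g : R -> R * R) (I : set R) : Prop :=
  forall t, I t ->
    [/\ derivable g t 1, derive1 g t != 0,
        derivable (derive1 g) t 1 & {for t, continuous (derive1n 2 g)}].

(* Signed with respect to the left normal [(- y', x')] of [g = (x, y)]. *)
Definition curvature (g : R -> R * R) (t : R) : R :=
  ((derive1 g t).1 * (derive1n 2 g t).2 - (derive1 g t).2 * (derive1n 2 g t).1)
    / enorm (derive1 g t) ^+ 3.

(* [g] is a regular parametrization of the level set of [u] near [p]. *)
Definition level_curve_at u p (g : R -> R * R) : Prop :=
  exists e : R, 0 < e /\ exists U, open_nbhs p U /\
    [/\ regular_C2_curve g `]- e, e[, g 0 = p &
        g @` `]- e, e[ = U `&` [set q | u q = u p]].

Definition left_normal v : R * R := (- v.2, v.1).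

(* The orientation is the one for which the left normal points in the direction
   in which [u] decreases. When [u] is C^2 near [p] with nonzero gradient at [p]
   there is exactly one such [k]: a parametrization exists by the implicit
   function theorem, and the value does not depend on it. The default value 0
   of [xget] is thus irrelevant outside the critical set. *)
Definition level_curvature u p : R :=
  xget 0 [set k | exists g, [/\ level_curve_at u p g,
    dot (gradient u p) (left_normal (derive1 g 0)) < 0 & k = curvature g 0]].

End plane.

(* Main.v *)
Require Import Defs.
From HB Require Import structures.
From mathcomp Require Import all_boot all_order all_algebra.
From mathcomp Require Import all_classical all_reals all_analysis.
From mathcomp Require Import ring lra.
Import Order.TTheory GRing.Theory Num.Theory.
Import numFieldNormedType.Exports.
Local Open Scope classical_set_scope.
Local Open Scope ring_scope.

(** If the level curves have curvature at least [k] in absolute value, a disc of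
    radius greater than [1 / k] in the domain leads to a contradiction that is
    visible on one well chosen circle concentric with the disc.

    The critical set [A] is countable: the points of [A] that are not limits of
    [A] are isolated, hence countably many, and the same holds for each of the
    finitely many iterated derived sets, the last of which is empty
    ([countable_iterated_derived_set0]). The distances from the centre of the
    disc to points of [A] are therefore countably many, so some radius [s] with
    [1 / k < s] gives a circle in the disc that avoids [A].

    On this circle [u] has a minimum and a maximum. At such a point [Du] is
    normal to the circle, say [Du = l n] with [n] the outward unit normal, and
    the second derivative of [u] along the circle, with respect to the angle, is
    [s ^ 2 K - s l], where [K] is the second derivative of [u] in the tangent
    direction. The level curve through the point is tangent to the circle, and
    its curvature is [|K| / |l|] in absolute value; so [|K| >= k |l| > |l| / s],
    which means that [s ^ 2 K] dominates [s l]. Hence [K > 0] at the minimum and [K < 0] at the maximum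
    ([circle_extremum_hessian]).

    The quantity [N = D^2 u (J Du, J Du)], with [J] the rotation by a right
    angle, equals [l ^ 2 K] at the extrema, is continuous along the circle, and
    satisfies [|N| >= k |Du| ^ 3 > 0] everywhere on it ([level_curvature_le]).
    Having opposite signs at the two extrema, it must vanish in between: this is
    the contradiction ([circle_curvature_bound]). *)

(** * Countability of sets with an empty iterated derived set *)

(** An isolated point is the only point of [S] in some ball with rational centre
    and radius around it, and there are countably many such balls. *)
Lemma countable_diff_limit_point {R : realType} (S : set (R * R)) :
  countable (S `\` limit_point S).
Proof.
pose B (q : (rat * rat) * rat) : set (R * R) :=
  ball ((ratr q.1.1, ratr q.1.2) : R * R) (ratr q.2).
pose h p := xget (0, 0, 0) [set q | B q p /\ forall y, S y -> B q y -> y = p].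
have hP p : (S `\` limit_point S) p ->
    B (h p) p /\ forall y, S y -> B (h p) y -> y = p.
  move=> [Sp nlp]; rewrite /h.
  apply: (@xgetPex _ _ [set q | B q p /\ forall y, S y -> B q y -> y = p]).
  have [U [Up SU]] : exists U, nbhs p U /\ forall y, S y -> U y -> y = p.
    apply: contrapT => H; apply: nlp => U Up; apply: contrapT => H'.
    apply: H; exists U; split=> // y Sy Uy; apply: contrapT => /eqP yp.
    by apply: H'; exists y.
  have /nbhs_ballP[e /= e0 eU] := Up.
  have [q /= /andP[q0 qe]] : exists q, ratr q \in `]0, e / 2[.
    by apply: rat_in_itvoo; rewrite divr_gt0.
  have near_rat (x : R) : exists c : rat, `|x - ratr c| < ratr q.
    have [|c /= /andP[xc cx]] := @rat_in_itvoo _ (x - ratr q) (x + ratr q).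
      by rewrite ltrD2l (lt_trans _ q0) // oppr_lt0.
    by exists c; rewrite distrC ltr_distl; apply/andP.
  have [a ap] := near_rat p.1; have [b bp] := near_rat p.2.
  exists (a, b, q); split; first by split; rewrite /ball/= distrC.
  have eq2 : ratr q + ratr q < e by rewrite [e]splitr ltrD.
  move=> y Sy [/= ay yb]; apply: SU => //; apply: eU.
  split; apply: (le_ball (ltW eq2)).
    exact: (ball_triangle (ap : ball p.1 (ratr q) (ratr a)) ay).
  exact: (ball_triangle (bp : ball p.2 (ratr q) (ratr b)) yb).
apply/countable_injP; exists (choice.pickle \o h) => x y /set_mem xS /set_mem yS.
move=> /(pcan_inj choice.pickleK) hxy.
have [_ yP] := hP _ yS; apply: yP; first by case: xS.
by rewrite -hxy; case: (hP _ xS).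
Qed.

(** Each derivation removes the isolated points only, and those are countably
    many. *)
Lemma countable_iterated_derived_set0 {R : realType} {D S : set (R * R)} {n} :
  S `<=` D -> iterated_derived_set D S n = set0 -> countable S.
Proof.
move=> SD; elim: n S SD => [S _ /= ->|n IH S SD Dn0]; first exact: countable0.
have cS' : countable (derived_set D S).
  by apply: IH; [move=> ? [] | rewrite -Dn0 /iterated_derived_set iterSr].
pose F (b : bool) := if b then derived_set D S else S `\` limit_point S.
have : countable (\bigcup_(b in [set: bool]) F b).
  apply: bigcup_countable => // -[] _ //; exact: countable_diff_limit_point.
apply: sub_countable; apply: subset_card_le => p Sp.
have [lp|nlp] := pselect (limit_point S p); last by exists false.
by exists true => //; split=> //; exact: SD.
Qed.

(** * Chain rule for functions with continuous partial derivatives *)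

Lemma is_derive_line {R : realType} {V W : normedModType R} {f : V -> W}
    {q v : V} {t : R} :
  derivable f (t *: v + q) v ->
  is_derive t 1 (fun s : R => f (s *: v + q)) ('D_v f (t *: v + q)).
Proof.
have E : (fun h : R => h^-1 *: (((fun s : R => f (s *: v + q)) \o shift t) (h *: 1)
      - f (t *: v + q))) =
    (fun h => h^-1 *: ((f \o shift (t *: v + q)) (h *: v) - f (t *: v + q))).
  by apply/funext => h /=; rewrite [h *: 1]mulr1 scalerDl addrA.
by move=> fv; split; rewrite /derivable /derive E.
Qed.

(** The mean value theorem from the origin, uniform in the sign of [h]: this is
    the form needed for increments along the coordinate axes. *)
Lemma mean_value_segment {R : realType} {F dF : R -> R} {h : R} :
  (forall t : R, `|t| <= `|h| -> is_derive t 1 F (dF t)) ->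
  exists2 t, `|t| <= `|h| & F h - F 0 = dF t * h.
Proof.
move=> FdF.
have cF a b : (forall t, t \in `[a, b] -> `|t| <= `|h|) ->
    {within `[a, b], continuous F}.
  by move=> ab; apply: derivable_within_continuous => t /ab /FdF [].
have [h0|h0] := leP 0 h.
  have tE t : t \in `[0, h] -> `|t| <= `|h|.
    by rewrite in_itv/= => /andP[t0 th]; rewrite !ger0_norm.
  have [||c /tE ch ->] := @MVT_segment _ F dF _ _ h0.
  - by move=> t /subset_itv_oo_cc /tE /FdF.
  - exact: cF.
  - by exists c; rewrite // subr0.
have tE t : t \in `[h, 0] -> `|t| <= `|h|.
  by rewrite in_itv/= => /andP[t0 th]; rewrite !ler0_norm ?lerN2 // ltW.
have [||c /tE ch Fc] := @MVT_segment _ F dF _ _ (ltW h0).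
  by move=> t /subset_itv_oo_cc /tE /FdF.
  exact: cF.
by exists c; rewrite // -opprB Fc sub0r mulrN opprK.
Qed.

(** The increment of [f] from [p] to [h + p] is split into a vertical step and
    a horizontal one. The mean value theorem expresses each as a partial
    derivative at a nearby point times a coordinate of [h], and continuity of the
    partial derivatives bounds the error by [eps * `|h|]. *)
Lemma C1_on_differentiable {R : realType} {D : set (R * R)} {f : R * R -> R} {p} :
  open D -> C1_on D f -> D p -> differentiable f p.
Proof.
move=> oD fC1 Dp.
set a := 'D_e1 f p; set b := 'D_e2 f p.
pose df (h : R * R) : R := h.1 * a + h.2 * b.
have lin_df : linear df.
  by move=> k h h'; rewrite /df /= /GRing.scale /=; ring.
pose dfM := GRing.isLinear.Build _ _ _ _ _ lin_df.
pose dfL : {linear _ -> _} := HB.pack df dfM.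
have cdf : continuous dfL.
  move=> h; apply: cvgD; apply: cvgM; try exact: cvg_cst.
    exact: cvg_fst.
  exact: cvg_snd.
suff expand : f \o shift p = (cst (f p) + dfL) +o_ (0 : R * R) id.
  by apply/diff_locallyP; rewrite (diff_unique cdf expand).
apply/eqaddoP => eps eps0.
have e20 : 0 < eps / 2 by rewrite divr_gt0.
have near_p : \forall q \near p,
    [/\ D q, `|a - 'D_e1 f q| <= eps / 2 & `|b - 'D_e2 f q| <= eps / 2].
  have [_ c1] := fC1 _ _ Dp (or_introl erefl).
  have [_ c2] := fC1 _ _ Dp (or_intror erefl).
  have nD : \forall q \near p, D q by apply: open_nbhs_nbhs; split.
  have na : \forall q \near p, `|a - 'D_e1 f q| <= eps / 2.
    by move/cvgrPdist_le : c1 => /(_ _ e20).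
  have nb : \forall q \near p, `|b - 'D_e2 f q| <= eps / 2.
    by move/cvgrPdist_le : c2 => /(_ _ e20).
  by apply: filterS3 nD na nb => q Dq aq bq; exact: And3 Dq aq bq.
have /nbhs_ballP[d /= d0 ball_d] := near_p.
near=> h.
have hd : `|h| < d.
  near: h; apply/nbhs_ballP; exists d => //= h.
  by rewrite -ball_normE /= sub0r normrN.
have h12 : `|h.1| <= `|h| /\ `|h.2| <= `|h|.
  by rewrite prod_normE; split; rewrite le_max lexx ?orbT.
case: h12 => h1h h2h.
have inball x y : `|x| <= `|h| -> `|y| <= `|h| -> ball p d (x *: e1 + (y *: e2 + p)).
  move=> xh yh; split; rewrite /ball/= distrC.
    have -> : x * 1 + (y * 0 + p.1) - p.1 = x by ring.
    exact: le_lt_trans hd.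
  have -> : x * 0 + (y * 1 + p.2) - p.2 = y by ring.
  exact: le_lt_trans hd.
have is_d1 (t : R) : `|t| <= `|h.1| ->
    is_derive t 1 (fun t : R => f (t *: e1 + (h.2 *: e2 + p)))
      ('D_e1 f (t *: e1 + (h.2 *: e2 + p))).
  move=> th; have [Dt _ _] := ball_d _ (inball t h.2 (le_trans th h1h) h2h).
  by have [] := fC1 _ _ Dt (or_introl erefl); move=> /is_derive_line.
have inball2 y : `|y| <= `|h| -> ball p d (y *: e2 + p).
  by move=> yh; have := inball 0 y; rewrite scale0r add0r normr0; apply.
have is_d2 (t : R) : `|t| <= `|h.2| ->
    is_derive t 1 (fun t : R => f (t *: e2 + p)) ('D_e2 f (t *: e2 + p)).
  move=> th; have [Dt _ _] := ball_d _ (inball2 t (le_trans th h2h)).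
  by have [] := fC1 _ _ Dt (or_intror erefl); move=> /is_derive_line.
have [t1 t1h E1] := mean_value_segment is_d1.
have [t2 t2h E2] := mean_value_segment is_d2.
have [_ D1 _] := ball_d _ (inball _ _ (le_trans t1h h1h) h2h).
have [_ _ D2] := ball_d _ (inball2 _ (le_trans t2h h2h)).
have -> : (f \o shift p - (cst (f p) + dfL)) h =
   - (a - 'D_e1 f (t1 *: e1 + (h.2 *: e2 + p))) * h.1
   - (b - 'D_e2 f (t2 *: e2 + p)) * h.2.
  have hE : h + p = h.1 *: e1 + (h.2 *: e2 + p).
    by rewrite [LHS]surjective_pairing; congr pair; rewrite /= /GRing.scale /=; ring.
  rewrite /= /df -[LHS]/(f (h + p) - (f p + (h.1 * a + h.2 * b))) hE.
  move: E1 E2; cbv beta; rewrite !scale0r !add0r => E1 E2.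
  have -> : f (h.1 *: e1 + (h.2 *: e2 + p)) =
    'D_e1 f (t1 *: e1 + (h.2 *: e2 + p)) * h.1 + 'D_e2 f (t2 *: e2 + p) * h.2 + f p.
    by rewrite -E1 -E2; ring.
  ring.
rewrite (le_trans (ler_normB _ _)) // mulNr normrN !normrM.
rewrite [X in _ <= X * _]splitr mulrDl lerD //; apply: ler_pM => //.
Unshelve. all: by end_near. Qed.

Lemma is_derive_comp_curve {R : realType} {f : R * R -> R} {g : R -> R * R} {t : R} :
  derivable g t 1 -> differentiable f (g t) ->
  is_derive t 1 (f \o g) (dot (gradient f (g t)) (derive1 g t)).
Proof.
move=> gt ft; have dg : differentiable g t by apply/derivable1_diffP.
have dfg := differentiable_comp dg ft.
apply: DeriveDef; first exact: diff_derivable.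
rewrite deriveE // diff_comp //=.
have -> : 'd g t 1 = derive1 g t by rewrite derive1E deriveE.
have -> : derive1 g t = (derive1 g t).1 *: e1 + (derive1 g t).2 *: e2.
  by rewrite [LHS]surjective_pairing; congr pair; rewrite /= /GRing.scale /=; ring.
rewrite linearD !linearZ /dot /gradient !deriveE //=.
by rewrite /GRing.scale /=; ring.
Qed.

Lemma is_derive_fst {R : realType} {g : R -> R * R} {t : R} {dg} :
  is_derive t 1 g dg -> is_derive t 1 (fun s => (g s).1) dg.1.
Proof.
move=> [gt gdg].
have cdg : (fun h => h^-1 *: ((g \o shift t) (h *: 1) - g t)) @ 0^' --> dg.
  by rewrite -gdg; exact: gt.
have c1 : (fun h => h^-1 *: (((fun s => (g s).1) \o shift t) (h *: 1) - (g t).1))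
    @ 0^' --> dg.1.
  have cf : {for dg, continuous (@fst R R)} by exact: cvg_fst.
  exact: (continuous_cvg _ cf cdg).
by split; [apply/cvg_ex; exists dg.1|exact/cvg_lim].
Qed.

Lemma is_derive_snd {R : realType} {g : R -> R * R} {t : R} {dg} :
  is_derive t 1 g dg -> is_derive t 1 (fun s => (g s).2) dg.2.
Proof.
move=> [gt gdg].
have cdg : (fun h => h^-1 *: ((g \o shift t) (h *: 1) - g t)) @ 0^' --> dg.
  by rewrite -gdg; exact: gt.
have c1 : (fun h => h^-1 *: (((fun s => (g s).2) \o shift t) (h *: 1) - (g t).2))
    @ 0^' --> dg.2.
  have cf : {for dg, continuous (@snd R R)} by exact: cvg_snd.
  exact: (continuous_cvg _ cf cdg).
by split; [apply/cvg_ex; exists dg.2|exact/cvg_lim].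
Qed.

Lemma is_derive_pair {R : realType} {a b : R -> R} {t : R} {da db} :
  is_derive t 1 a da -> is_derive t 1 b db ->
  is_derive t 1 (fun s => (a s, b s)) (da, db).
Proof.
move=> [ad aE] [bd bE].
have c1 : (fun h => h^-1 *: (((fun s => (a s, b s)) \o shift t) (h *: 1) - (a t, b t)))
    @ 0^' --> (da, db).
  have ca : (fun h => h^-1 *: ((a \o shift t) (h *: 1) - a t)) @ 0^' --> da.
    by rewrite -aE; exact: ad.
  have cb : (fun h => h^-1 *: ((b \o shift t) (h *: 1) - b t)) @ 0^' --> db.
    by rewrite -bE; exact: bd.
  exact: (cvg_pair ca cb).
by split; [apply/cvg_ex; exists (da, db)|exact/cvg_lim].
Qed.

(** At [v = left_normal (gradient u p)] this is the curvature at [p] of the level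
    curve times the cube of the length of the gradient. *)
Definition hessian_form {R : realType} (u : R * R -> R) (p v : R * R) : R :=
  'D_e1 ('D_e1 u) p * v.1 ^+ 2 + ('D_e2 ('D_e1 u) p + 'D_e1 ('D_e2 u) p) * (v.1 * v.2)
  + 'D_e2 ('D_e2 u) p * v.2 ^+ 2.

Lemma second_derivative_along_curve {R : realType} {D : set (R * R)} {u : R * R -> R}
    {g : R -> R * R} {t : R} :
  open D -> C2_on D u -> D (g t) ->
  (\forall s \near t, derivable g s 1) -> derivable (derive1 g) t 1 ->
  is_derive t 1 (derive1 (u \o g))
    (hessian_form u (g t) (derive1 g t) + dot (gradient u (g t)) (derive1n 2 g t)).
Proof.
move=> oD [u1 u11 u21] Dgt ng g't.
have gt := nbhs_singleton ng.
have cg : {for t, continuous g}.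
  by apply: differentiable_continuous; apply/derivable1_diffP.
have nD : \forall s \near t, D (g s) by apply: cg; exact: open_nbhs_nbhs.
have nE : \forall s \near t,
   dot (gradient u (g s)) (derive1 g s) = derive1 (u \o g) s.
  near=> s; have gs : derivable g s 1 by near: s.
  have us : differentiable u (g s) by apply: (C1_on_differentiable oD u1); near: s.
  by rewrite [RHS]derive1E; have [_ ->] := is_derive_comp_curve gs us.
have H v : C1_on D ('D_v u) ->
    is_derive t 1 ('D_v u \o g) (dot (gradient ('D_v u) (g t)) (derive1 g t)).
  move=> uv; apply: is_derive_comp_curve => //.
  exact: (C1_on_differentiable oD uv Dgt).
have g'' : is_derive t 1 (derive1 g) (derive1n 2 g t).
  have -> : derive1n 2 g t = 'D_1 (derive1 g) t by exact: derive1E.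
  exact: (derivableP g't).
have P1 := is_deriveM (H _ u11) (is_derive_fst g'').
have P2 := is_deriveM (H _ u21) (is_derive_snd g'').
have P12 := is_deriveD P1 P2.
have := near_eq_is_derive nE P12.
move/is_derive_eq; apply.
have expand (P S S' Q a b x y X Y : R) :
    a * X + x * (P * x + S * y) + (b * Y + y * (S' * x + Q * y)) =
    P * x ^+ 2 + (S + S') * (x * y) + Q * y ^+ 2 + (a * X + b * Y) by ring.
exact: expand.
Unshelve. all: by end_near. Qed.

(** * Curvature of level curves in terms of second derivatives *)

Lemma dot_gt0 {R : realType} {v : R * R} : v != 0 -> 0 < dot v v.
Proof.
move=> v0; rewrite lt_def /dot -!expr2 addr_ge0 ?sqr_ge0 // andbT.
rewrite paddr_eq0 ?sqr_ge0 // !expf_eq0 /=.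
by apply: contra v0 => /andP[/eqP v10 /eqP v20]; rewrite [v]surjective_pairing v10 v20.
Qed.

Lemma dot_eq0_left_normal {R : realType} {v w : R * R} :
  v != 0 -> dot v w = 0 -> exists m, w = m *: left_normal v.
Proof.
move=> v0 vw; have vv : dot v v != 0 by rewrite gt_eqF ?dot_gt0.
exists (dot (left_normal v) w / dot v v).
move: vw vv; case: v v0 => a b _; case: w => x y; rewrite /dot /left_normal /= => vw vv.
congr pair; rewrite /GRing.scale /=.
  apply: (mulIf vv); rewrite mulrAC divfK //.
  have -> : x * (a * a + b * b) = (- b * x + a * y) * - b + a * (a * x + b * y) by ring.
  by rewrite vw mulr0 addr0.
apply: (mulIf vv); rewrite mulrAC divfK //.
have -> : y * (a * a + b * b) = (- b * x + a * y) * a + b * (a * x + b * y) by ring.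
by rewrite vw mulr0 addr0.
Qed.

Lemma hessian_formZ {R : realType} (u : R * R -> R) p (m : R) v :
  hessian_form u p (m *: v) = m ^+ 2 * hessian_form u p v.
Proof.
have quadZ (P S Q x y : R) : P * (m * x) ^+ 2 + S * ((m * x) * (m * y)) + Q * (m * y) ^+ 2
    = m ^+ 2 * (P * x ^+ 2 + S * (x * y) + Q * y ^+ 2) by ring.
exact: quadZ.
Qed.

Lemma enormZ {R : realType} (m : R) v : enorm (m *: v) = `|m| * enorm v.
Proof.
rewrite /enorm -sqrtr_sqr -sqrtrM ?sqr_ge0 //; congr Num.sqrt.
by rewrite /dot /= /GRing.scale /=; ring.
Qed.

Lemma enorm_left_normal {R : realType} (v : R * R) : enorm (left_normal v) = enorm v.
Proof. by rewrite /enorm /dot /left_normal /=; congr Num.sqrt; ring. Qed.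

(** Let [g] parametrize the level set near [p]. Differentiating [u \o g = u p]
    once shows that [g'] is a multiple [m] of the left normal of the gradient;
    differentiating again gives [dot Du g'' = - m ^ 2 N], with [N] the right-hand
    side without absolute value. The numerator of the curvature of [g] is
    [- m * dot Du g'' = m ^ 3 N], and its denominator is [(|m| |Du|) ^ 3], so
    equality holds for every such [g]. The statement is an inequality because it
    also covers the default value 0 of [level_curvature]. *)
Lemma level_curvature_le {R : realType} {D : set (R * R)} {u : R * R -> R} {p} :
  open D -> C2_on D u -> D p -> gradient u p != 0 ->
  `|level_curvature u p| * enorm (gradient u p) ^+ 3 <=
    `|hessian_form u p (left_normal (gradient u p))|.
Proof.
move=> oD uC2 Dp gp0; rewrite /level_curvature; case: xgetP => [k -> [g]|_]; last first.
  by rewrite normr0 mul0r.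
move=> [[e [e0 [U [_ [greg g0 gU]]]]] _ ->].
have I0 : `]- e, e[%classic (0 : R) by rewrite /= in_itv /= oppr_lt0 e0.
have nI : \forall t \near (0 : R), `]- e, e[%classic t.
  by apply: open_nbhs_nbhs; split => //; exact: itv_open.
have ng : \forall t \near (0 : R), derivable g t 1.
  by near=> t; have [] : [/\ derivable g t 1, derive1 g t != 0,
    derivable (derive1 g) t 1 & {for t, continuous (derive1n 2 g)}] by apply: greg; near: t.
have [dg0 g'0 dg'0 _] := greg _ I0.
have gc : \forall t \near (0 : R), u p = (u \o g) t.
  near=> t; have : (g @` `]- e, e[%classic) (g t) by exists t => //; near: t.
  by rewrite gU => -[_ /= ->].
have gc' : \forall t \near (0 : R), 0 = derive1 (u \o g) t.
  have /near_join gcc := gc.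
  near=> t; rewrite derive1E; have <- : 'D_1 (cst (u p)) t = 'D_1 (u \o g) t.
    by apply: near_eq_derive; near: t.
  by rewrite derive_cst.
have Dg0 : D (g 0) by rewrite g0.
have [u1 _ _] := uC2.
have E1 : dot (gradient u p) (derive1 g 0) = 0.
  have [_] := is_derive_comp_curve dg0 (C1_on_differentiable oD u1 Dg0).
  by rewrite g0 => <-; rewrite -derive1E -(nbhs_singleton gc').
have E2 : hessian_form u p (derive1 g 0) + dot (gradient u p) (derive1n 2 g 0) = 0.
  have [_] := second_derivative_along_curve oD uC2 Dg0 ng dg'0.
  by rewrite g0 => <-; rewrite -(near_eq_derive _ gc') derive_cst.
have [m g'E] := dot_eq0_left_normal gp0 E1.
have m0 : m != 0 by apply: contra g'0 => /eqP m0; rewrite g'E m0 scale0r.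
rewrite /curvature g'E enormZ enorm_left_normal.
have -> : (m *: left_normal (gradient u p)).1 * (derive1n 2 g 0).2 -
          (m *: left_normal (gradient u p)).2 * (derive1n 2 g 0).1 =
          m ^+ 3 * hessian_form u p (left_normal (gradient u p)).
  move: E2; rewrite g'E hessian_formZ => /eqP; rewrite addr_eq0 => /eqP E2.
  have expand (a b X Y : R) :
      m * - b * Y - m * a * X = m * - (a * X + b * Y) by ring.
  by rewrite exprS -mulrA E2 -expand.
have cancel (h n : R) : 0 < n -> `|m ^+ 3 * h / (`|m| * n) ^+ 3| * n ^+ 3 = `|h|.
  move=> n0; rewrite !(normrX, normrM, normfV) normr_id (gtr0_norm n0).
  by field; rewrite normr_eq0 m0 gt_eqF.
by rewrite cancel // sqrtr_gt0 dot_gt0.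
Unshelve. all: by end_near. Qed.

(** * Three facts on the real line *)

(** If [d] were negative, [derive1 F] would be negative just to the right of [t],
    and [F] would decrease below its minimum. *)
Lemma second_derivative_test {R : realType} {F : R -> R} {t d : R} :
  (forall s, derivable F s 1) -> is_derive t 1 (derive1 F) d ->
  (forall s, F t <= F s) -> derive1 F t = 0 /\ 0 <= d.
Proof.
move=> Fd [F't F'tE] Ft.
have F't0 : derive1 F t = 0.
  have t1t1 : t \in `]t - 1, t + 1[ by rewrite in_itv /= ltrBlDr ltrDl ltr01.
  have t1t : t - 1 <= t + 1 by rewrite lerD2l ge0_cp.
  have [_ F't0] := derive1_at_min t1t (fun s _ => Fd s) t1t1 (fun s _ => Ft s).
  by rewrite derive1E.
split=> //; rewrite leNgt; apply/negP => d0.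
have cd : (fun h => h^-1 *: ((derive1 F \o shift t) (h *: 1) - derive1 F t)) @ 0^' --> d.
  by rewrite -F'tE; exact: F't.
have : \forall h \near 0^', h^-1 *: ((derive1 F \o shift t) (h *: 1) - derive1 F t) < 0.
  by move: cd => /cvgr_lt; apply.
rewrite F't0 /= => /nbhs_ballP[r /= r0 Hr].
have F'neg s : s \in `]t, t + r[ -> derive1 F s < 0.
  rewrite in_itv /= => /andP[ts sr].
  have st : 0 < s - t by rewrite subr_gt0.
  have /= := Hr (s - t); rewrite /ball /= sub0r normrN gtr0_norm // ltrBlDl.
  move=> /(_ sr); rewrite gt_eqF // => /(_ isT).
  by rewrite [(s - t)%:A]mulr1 subrK subr0 /GRing.scale /= pmulr_rlt0 ?invr_gt0.
have tr : t < t + r / 2 by rewrite ltrDl divr_gt0.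
have FdF x : x \in `]t, t + r / 2[ -> is_derive x 1 F (derive1 F x).
  by move=> _; rewrite derive1E; exact: (derivableP (Fd x)).
have cF : {within `[t, t + r / 2], continuous F}.
  by apply: derivable_within_continuous => x _; exact: Fd.
have [c ctr FE] := MVT tr FdF cF.
have := Ft (t + r / 2); rewrite -subr_ge0 FE leNgt => /negP; apply.
rewrite pmulr_llt0 ?subr_gt0 //; apply: F'neg; move: ctr.
rewrite !in_itv /= => /andP[-> /= cr].
by apply: lt_trans cr _; rewrite ltrD2l; lra.
Qed.

Lemma periodic_fundamental_domain {R : realType} {U : zmodType} {f : R -> U} {T : R} :
  0 < T -> periodic f T -> forall x, exists2 y, y \in `[0, T] & f y = f x.
Proof.
move=> T0 fT x; have T1 : T != 0 by rewrite gt_eqF.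
have fTz (z : int) y : f (y + z%:~R * T) = f y.
  case: z => n; first by rewrite -pmulrn mulr_natl (periodicn fT).
  rewrite NegzE mulrNz mulNr -pmulrn mulr_natl.
  by rewrite -[in RHS](subrK (T *+ n.+1) y) (periodicn fT).
exists (x + (- Num.floor (x / T))%:~R * T); last exact: fTz.
have /andP[fl1 fl2] := floor_itv (x / T).
rewrite in_itv /= mulrNz mulNr subr_ge0 -ler_pdivlMr // fl1 /=.
move: fl2; rewrite ltr_pdivrMr // intrD mulrDl mul1r => fl2.
by rewrite lerBlDr addrC ltW.
Qed.

Lemma countable_avoid_itv {R : realType} (E : set R) (a b : R) :
  countable E -> a < b -> exists2 s, a < s < b & ~ E s.
Proof.
move=> cE ab; apply: contrapT => H.
have abE : `]a, b[%classic `<=` E.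
  move=> s /=; rewrite in_itv /= => sab; apply: contrapT => Es; apply: H.
  by exists s.
have /countable_lebesgue_measure0 := sub_countable (subset_card_le abE) cE.
rewrite lebesgue_measure_itv /= lte_fin ab -EFinB => -[] /eqP.
by rewrite subr_eq0 gt_eqF.
Qed.

(** * Functions restricted to a circle *)

Definition circle {R : realType} (c : R * R) (s t : R) : R * R :=
  (c.1 + s * cos t, c.2 + s * sin t).

Lemma is_derive_circle {R : realType} (c : R * R) (s t : R) :
  is_derive t 1 (circle c s) (s *: left_normal (cos t, sin t)).
Proof.
apply: is_derive_pair.
  apply: is_derive_eq; rewrite add0r /left_normal /= /GRing.scale /=; ring.
apply: is_derive_eq; rewrite add0r /left_normal /= /GRing.scale /=; ring.
Qed.

Lemma derive1_circle {R : realType} (c : R * R) (s : R) :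
  derive1 (circle c s) = fun t => s *: left_normal (cos t, sin t).
Proof.
by apply/funext => t; rewrite derive1E; have [_ ->] := is_derive_circle c s t.
Qed.

Lemma is_derive_derive1_circle {R : realType} (c : R * R) (s t : R) :
  is_derive t 1 (derive1 (circle c s)) (- s *: (cos t, sin t)).
Proof.
rewrite derive1_circle; apply: is_derive_pair.
  apply: is_derive_eq; rewrite /= /GRing.scale /=; ring.
apply: is_derive_eq; rewrite /= /GRing.scale /=; ring.
Qed.

Lemma periodic_circle {R : realType} (c : R * R) (s : R) :
  periodic (circle c s) (pi *+ 2).
Proof. by move=> t; rewrite /circle cosD2pi sinD2pi. Qed.

Lemma enorm_circle {R : realType} (c : R * R) (s t : R) :
  0 <= s -> enorm (circle c s t - c) = s.
Proof.
move=> s0; rewrite -[RHS]ger0_norm // -[RHS]mulr1 -sqrtr1 -(cos2Dsin2 t) -sqrtr_sqr.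
rewrite -sqrtrM ?sqr_ge0 // /enorm; congr Num.sqrt.
by rewrite /dot /circle /=; ring.
Qed.

(** The sign [eps] treats minima ([eps = 1]) and maxima ([eps = - 1]) together.
    Write [n] for the unit normal, [gradient u = l n] and [K] for the second
    derivative in the tangent direction. The second derivative test gives
    [eps * l <= s * (eps * K)], hence [- |l| <= s * (eps * K)]. The curvature
    bound gives [s * |K| >= s * k * |l| > |l|], so that [eps * K] cannot be
    negative or zero. *)
Lemma circle_extremum_hessian {R : realType} {D : set (R * R)} {u : R * R -> R}
    {c : R * R} {s t k eps : R} :
  open D -> C2_on D u -> 0 < s -> 1 < s * k -> (forall x, D (circle c s x)) ->
  gradient u (circle c s t) != 0 ->
  k * enorm (gradient u (circle c s t)) ^+ 3 <=
    `|hessian_form u (circle c s t) (left_normal (gradient u (circle c s t)))| ->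
  `|eps| = 1 -> (forall x, eps * u (circle c s t) <= eps * u (circle c s x)) ->
  0 < eps * hessian_form u (circle c s t) (left_normal (gradient u (circle c s t))).
Proof.
move=> oD uC2 s0 sk1 cD gp0 kp eps1 ext.
have dcirc x : derivable (circle c s) x 1 by case: (is_derive_circle c s x).
have [u1 _ _] := uC2.
have dF x := is_derive_comp_curve (dcirc x) (C1_on_differentiable oD u1 (cD x)).
have dFd x : derivable (u \o circle c s) x 1 by case: (dF x).
have dF' : is_derive t 1 (derive1 (u \o circle c s)) (s ^+ 2 *
   hessian_form u (circle c s t) (left_normal (cos t, sin t))
   - s * dot (gradient u (circle c s t)) (cos t, sin t)).
  have d'c : derivable (derive1 (circle c s)) t 1.
    by case: (is_derive_derive1_circle c s t).
  have nc : \forall x \near t, derivable (circle c s) x 1 by near=> x; exact: dcirc.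
  have := second_derivative_along_curve oD uC2 (cD t) nc d'c.
  have -> : derive1n 2 (circle c s) t = - s *: (cos t, sin t).
    have [_ <-] := is_derive_derive1_circle c s t; exact: derive1E.
  rewrite derive1_circle hessian_formZ => dF2; apply: (is_derive_eq dF2); congr (_ + _).
  have dotZ (a b x y : R) : a * (- s * x) + b * (- s * y) = - (s * (a * x + b * y)).
    by ring.
  exact: dotZ.
pose F x := eps * (u \o circle c s) x.
have Fd x : derivable F x 1 by apply: derivableM.
have F'E : derive1 F = eps \*: derive1 (u \o circle c s).
  by apply/funext => x; rewrite /F derive1Ml.
have FF' := is_deriveZ eps dF'; rewrite -F'E in FF'.
have [] := second_derivative_test Fd FF' ext.
rewrite F'E /= derive1E; have [_ ->] := dF t.
rewrite derive1_circle.
have eps0 : eps != 0 by rewrite -normr_eq0 eps1 oner_neq0.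
move/eqP; rewrite mulf_eq0 (negbTE eps0) /= => /eqP.
move: (gradient u (circle c s t)) gp0 kp => g gp0 kp.
set n := (cos t, sin t); set l := dot g n; set K := hessian_form u _ (left_normal n).
move=> gn F2; have {F2} F'' : 0 <= eps * (s ^+ 2 * K - s * l) by exact: F2.
have gl : g = l *: n.
  have gn0 : - g.1 * sin t + g.2 * cos t = 0.
    apply: (mulfI (lt0r_neq0 s0)); rewrite mulr0 -gn /dot /n /= /GRing.scale /=; ring.
  rewrite [LHS]surjective_pairing /l /dot /n; congr pair; rewrite /GRing.scale /=.
    rewrite -[LHS]mulr1 -(cos2Dsin2 t).
    have -> : (g.1 * cos t + g.2 * sin t) * cos t = g.1 * (cos t ^+ 2 + sin t ^+ 2)
      + (- g.1 * sin t + g.2 * cos t) * sin t by ring.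
    by rewrite gn0 mul0r addr0.
  rewrite -[LHS]mulr1 -(cos2Dsin2 t).
  have -> : (g.1 * cos t + g.2 * sin t) * sin t = g.2 * (cos t ^+ 2 + sin t ^+ 2)
      - (- g.1 * sin t + g.2 * cos t) * cos t by ring.
  by rewrite gn0 mul0r subr0.
have l0 : l != 0 by apply: contra gp0 => /eqP l0; rewrite gl l0 scale0r.
have n1 : enorm n = 1.
  by rewrite /enorm /dot /n /= -!expr2 cos2Dsin2 sqrtr1.
have NE : hessian_form u (circle c s t) (left_normal g) = l ^+ 2 * K.
  rewrite [in LHS]gl -hessian_formZ; congr hessian_form.
  by rewrite /left_normal; congr pair; rewrite /= /GRing.scale /=; ring.
have {}kp : k * `|l| <= `|K|.
  have l2 : 0 < `|l| ^+ 2 by rewrite exprn_gt0 // normr_gt0.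
  rewrite -(ler_pM2l l2); move: kp.
  by rewrite NE gl enormZ n1 mulr1 normrM normrX; congr (_ <= _); ring.
rewrite NE mulrCA pmulr_rgt0; last by rewrite exprn_even_gt0.
rewrite ltNge; apply/negP => K0.
have absK : `|K| = - (eps * K) by rewrite -[LHS]mul1r -eps1 -normrM ler0_norm.
have absl : - `|l| <= eps * l.
  by rewrite lerNl -[leRHS]mul1r -eps1 -normrM -normrN ler_norm.
have F2 : eps * l <= s * (eps * K).
  rewrite -(ler_pM2l s0) -subr_ge0; move: F''; congr (_ <= _); ring.
have lp : 0 < `|l| by rewrite normr_gt0.
have : s * (k * `|l|) <= `|l|.
  apply: (@le_trans _ _ (s * `|K|)); first by rewrite ler_pM2l.
  by rewrite absK mulrN lerNl (le_trans absl).
by rewrite mulrA leNgt ltr_pMl // sk1.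
Unshelve. all: by end_near. Qed.

Lemma continuous_circle {R : realType} (c : R * R) (s : R) :
  continuous (circle c s).
Proof.
move=> t; apply: differentiable_continuous; apply/derivable1_diffP.
by case: (is_derive_circle c s t).
Qed.

Lemma circle_max {R : realType} {f : R * R -> R} {c : R * R} {s : R} :
  continuous (f \o circle c s) ->
  exists t, forall x, f (circle c s x) <= f (circle c s t).
Proof.
move=> fc; have pi2 : 0 < pi *+ 2 :> R by rewrite mulrn_wgt0 // pi_gt0.
have [t _ tmax] := EVT_max (ltW pi2) (continuous_subspaceT fc).
exists t => x.
by have [y /tmax yt <-] := periodic_fundamental_domain pi2 (periodic_circle c s) x.
Qed.

(** Were [1 < s * k], the form [N] of the level curvature would be positive at a
    minimum of [u] on the circle and negative at a maximum, hence would vanish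
    somewhere between, where the assumed lower bound makes it nonzero. *)
Lemma circle_curvature_bound {R : realType} {D : set (R * R)} {u : R * R -> R}
    {c : R * R} {s k : R} :
  open D -> C2_on D u -> 0 < s -> 0 < k ->
  (forall t, D (circle c s t)) ->
  (forall t, gradient u (circle c s t) != 0) ->
  (forall t, k * enorm (gradient u (circle c s t)) ^+ 3 <=
    `|hessian_form u (circle c s t) (left_normal (gradient u (circle c s t)))|) ->
  s * k <= 1.
Proof.
move=> oD uC2 s0 k0 cD gn0 kP; rewrite leNgt; apply/negP => sk1.
have [u1 u11 u21] := uC2.
have cc (f : R * R -> R) :
    (forall p, D p -> {for p, continuous f}) -> continuous (f \o circle c s).
  by move=> fc t; exact: (continuous_comp (@continuous_circle _ c s t) (fc _ (cD t))).
have cu : continuous (u \o circle c s).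
  apply: cc => p Dp; apply: differentiable_continuous.
  exact: C1_on_differentiable oD u1 Dp.
have [t1 t1max] := circle_max cu.
have [t2 t2min] : exists t, forall x, - u (circle c s x) <= - u (circle c s t).
  by apply: (@circle_max _ (fun p => - u p)) => t; apply: continuousN; exact: cu.
pose N t := hessian_form u (circle c s t) (left_normal (gradient u (circle c s t))).
have N1 : N t1 < 0.
  rewrite -oppr_gt0 -mulN1r; apply: (circle_extremum_hessian oD uC2 s0 sk1) => //.
    by rewrite normrN1.
  by move=> x; rewrite !mulN1r lerN2.
have N2 : 0 < N t2.
  rewrite -[ltRHS]mul1r; apply: (circle_extremum_hessian oD uC2 s0 sk1) => //.
    by rewrite normr1.
  by move=> x; rewrite !mul1r -lerN2.
have cN : continuous N.
  have cD1 v w : C1_on D ('D_v u) -> w = e1 \/ w = e2 ->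
      continuous ('D_w ('D_v u) \o circle c s).
    by move=> uv wE; apply: cc => p Dp; have [] := uv _ _ Dp wE.
  have cD0 v : v = e1 \/ v = e2 -> continuous ('D_v u \o circle c s).
    by move=> vE; apply: cc => p Dp; have [] := u1 _ _ Dp vE.
  have c1 := cD0 _ (or_introl erefl); have c2 := cD0 _ (or_intror erefl).
  have c11 := cD1 _ _ u11 (or_introl erefl); have c12 := cD1 _ _ u11 (or_intror erefl).
  have c21 := cD1 _ _ u21 (or_introl erefl); have c22 := cD1 _ _ u21 (or_intror erefl).
  pose D1 t := ('D_e1 u \o circle c s) t; pose D2 t := ('D_e2 u \o circle c s) t.
  have -> : N = (fun t => ('D_e1 ('D_e1 u) \o circle c s) t * (D2 t * D2 t)
      - (('D_e2 ('D_e1 u) \o circle c s) t + ('D_e1 ('D_e2 u) \o circle c s) t)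
        * (D2 t * D1 t)
      + ('D_e2 ('D_e2 u) \o circle c s) t * (D1 t * D1 t)).
    have expand (P S S' Q a b : R) : P * (- b) ^+ 2 + (S + S') * (- b * a) + Q * a ^+ 2
        = P * (b * b) - (S + S') * (b * a) + Q * (a * a) by ring.
    by apply/funext => t; exact: expand.
  move=> t; apply: cvgD; first apply: cvgB.
  - by apply: cvgM; [exact: c11|apply: cvgM; exact: c2].
  - apply: cvgM; first by apply: cvgD; [exact: c12|exact: c21].
    by apply: cvgM; [exact: c2|exact: c1].
  - by apply: cvgM; [exact: c22|apply: cvgM; exact: c1].
have Nn0 t : N t != 0.
  rewrite -normr_gt0; apply: lt_le_trans (kP t).
  by rewrite mulr_gt0 // exprn_gt0 // sqrtr_gt0 dot_gt0.
have [t Nt] : exists t, N t = 0.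
  have IVT0 x y : x <= y -> Num.min (N x) (N y) <= 0 <= Num.max (N x) (N y) ->
      exists t, N t = 0.
    by move=> xy Nxy; have [t _ Nt] := IVT xy (continuous_subspaceT cN) Nxy; exists t.
  have N12 : N t1 < N t2 := lt_trans N1 N2.
  case: (leP t1 t2) => t12.
    apply: IVT0 t12 _; rewrite (min_idPl _) ?(max_idPr _) ?(ltW N1) ?(ltW N2) //.
      exact: ltW N12.
    exact: ltW N12.
  apply: IVT0 (ltW t12) _; rewrite (min_idPr _) ?(max_idPl _) ?(ltW N1) ?(ltW N2) //.
    exact: ltW N12.
  exact: ltW N12.
by have := Nn0 t; rewrite Nt eqxx.
Qed.

(** Among the uncountably many radii between [1 / k] and [r], one gives a circle
    without critical points. *)
Lemma disc_curvature_bound {R : realType} {D : set (R * R)} {u : R * R -> R}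
    {c : R * R} {r k : R} :
  open D -> C2_on D u -> countable (critical_set D u) ->
  closed_disc c r `<=` D -> 0 < k ->
  (forall p, (D `\` critical_set D u) p -> k <= `|level_curvature u p|) ->
  r * k <= 1.
Proof.
move=> oD uC2 cA rD k0 kP; rewrite leNgt; apply/negP => rk1.
have kr : k^-1 < r by rewrite -[ltLHS]mul1r ltr_pdivrMr.
have [s /andP[ks sr] sA] := countable_avoid_itv _ _ _
  (sub_countable (card_image_le (fun p => enorm (p - c)) (critical_set D u)) cA) kr.
have s0 : 0 < s by apply: lt_trans ks; rewrite invr_gt0.
have cD t : D (circle c s t).
  by apply: rD; rewrite /closed_disc /= enorm_circle ltW.
have cA' t : ~ critical_set D u (circle c s t).
  by move=> At; apply: sA; exists (circle c s t); rewrite // enorm_circle // ltW.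
have gn0 t : gradient u (circle c s t) != 0.
  by apply/eqP => gt0; apply: (cA' t).
have := circle_curvature_bound oD uC2 s0 k0 cD gn0.
rewrite leNgt -[s * k]mulrC -ltr_pdivrMl // mulr1 ks => /(_ _)/negP; apply => // t.
apply: le_trans (level_curvature_le oD uC2 (cD t) (gn0 t)).
by apply: ler_wpM2r; [rewrite exprn_ge0 // sqrtr_ge0|exact: kP].
Qed.



Theorem theorem3 (R : realType) (Omega : set (R * R)) (u : R * R -> R)
    (Omega_neq0 : Omega !=set0) (Omega_open : open Omega)
    (Omega_connected : connected Omega) (u_C2 : C2_on Omega u) :
  let A := critical_set Omega u in
  (exists n : nat, (0 < n)%N /\ iterated_derived_set Omega A n = set0) ->
  (inradius Omega <=
     1 / ereal_inf [set `|level_curvature u p|%:E | p in Omega `\` A])%E.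
Proof.
move=> A [n [_ An0]].
have cA : countable A by apply: countable_iterated_derived_set0 An0 => p [].
apply/ub_ereal_sup => _ [r [r0 [c rD]] <-].
rewrite mul1e; set m := ereal_inf _.
have mP p : (Omega `\` A) p -> (m <= `|level_curvature u p|%:E)%E.
  by move=> Op; apply: ereal_inf_lbound; exists p.
have m0 : (0 <= m)%E by apply: le_ereal_inf_tmp => _ [p _ <-]; rewrite lee_fin.
have bound k : 0 < k -> (k%:E <= m)%E -> r * k <= 1.
  move=> k0 km; apply: (disc_curvature_bound Omega_open u_C2 cA rD k0) => p Op.
  by rewrite -lee_fin (le_trans km) // mP.
move: m0 bound; case: m {mP} => [k| |] //; rewrite ?lee_fin => k0 bound.
  have [->|kn0] := eqVneq k 0; first by rewrite inve0 leey.
  have kp : 0 < k by rewrite lt_def kn0.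
  by rewrite inver (negbTE kn0) lee_fin -[leRHS]mul1r ler_pdivlMr // bound.
(* Without noncritical points the infimum is [+oo], and the bound for [k = 2 / r]
   is already absurd. *)
have := bound (2 / r) (divr_gt0 (ltr0Sn _ _) r0) (leey _).
by rewrite mulrCA divff ?gt_eqF // mulr1 leNgt ltr1n.
Qed.
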